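(* For any $k \in \mathbb{N}^*$, for any $m,q,n \in \mathbb{N}$ where $n \geq q$ and for any sequence $(a_N)$ of complex numbers defined for integers $N\in[q,n]$, we have $$\sum_{N_k=q}^{n}\cdots \sum_{N_2=q}^{N_3}\sum_{N_1=q}^{N_2}\binom{(N_2-N_1)+m}{m}a_{N_1}=\sum_{N=q}^{n}\binom{(n-N)+m+k-1}{m+k-1}a_{N}.$$
   Context: $\mathbb{N}=\{0,1,2,\dots\}$ and $\mathbb{N}^*=\{1,2,\dots\}$. The left-hand side is a $k$-fold nested sum: with $N_{k+1}:=n$, the index $N_j$ runs from $q$ to $N_{j+1}$ for $j=k,k-1,\dots,1$. In particular, for $k=1$, $N_2$ means $n$ and the left-hand side is $\sum_{N_1=q}^{n}\binom{(n-N_1)+m}{m}a_{N_1}$. *)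

(* Defs.v *)
From HB Require Import structures.
From mathcomp Require Import all_boot all_order all_algebra.
From mathcomp Require Import reals complex.

Set Implicit Arguments.
Unset Strict Implicit.
Unset Printing Implicit Defensive.

Import GRing.Theory.
Local Open Scope ring_scope.

(* For k >= 1, [nested_sum q f k n] is the k-fold sum over
   q <= N_1 <= N_2 <= ... <= N_k <= N_{k+1} := n of f N_2 N_1, the outermost
   index being N_k; the summand sees the upper bound N_2 of the innermost sum
   (N_2 = n when k = 1). The value at k = 0 is junk. *)
Fixpoint nested_sum (V : nmodType) (q : nat) (f : nat -> nat -> V)
    (k n : nat) {struct k} : V :=
  match k with
  | 0 => 0
  | 1 => \sum_(q <= N1 < n.+1) f n N1
  | k'.+1 => \sum_(q <= Nk < n.+1) nested_sum q f k' Nk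
  end.

(* Main.v *)
Require Import Defs.
From HB Require Import structures.
From mathcomp Require Import all_boot all_order all_algebra.
From mathcomp Require Import reals complex.

Set Implicit Arguments.
Unset Strict Implicit.
Unset Printing Implicit Defensive.

Import GRing.Theory.
Local Open Scope ring_scope.

(** Summing [a] against the weights 'C((n - N) + p, p) gives its (p + 1)-fold
    iterated partial sum at n.  Hence one further summation merely raises p
    by 1 ([sum_binomial_sum]), and the k-fold sum of the theorem, whose
    innermost sum already has parameter m, is reached after k - 1 such steps
    ([nested_sum_binomial]).  The single step is Pascal's rule: as functions
    of n, both sides of [sum_binomial_sum] grow by the same increment
    ([binomial_sum_succ]). *)

Definition binomial_sum (V : pzSemiRingType) (q : nat) (a : nat -> V)
    (p n : nat) : V :=
  \sum_(q <= N < n.+1) 'C((n - N) + p, p)%:R * a N.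

(** Pascal's rule, summed over N: at N = n.+1 the weights of both parameters
    are 1, which accounts for the term that [binomial_sum q a p.+1 n] lacks. *)
Lemma binomial_sum_succ (V : pzSemiRingType) (q : nat) (a : nat -> V)
    (p n : nat) (hq : (q <= n.+1)%N) :
  binomial_sum q a p.+1 n.+1 =
  binomial_sum q a p.+1 n + binomial_sum q a p n.+1.
Proof.
rewrite /binomial_sum big_nat_recr //= [in RHS](big_nat_recr n.+1) //=.
rewrite !subnn !add0n !binn addrA -big_split /=; congr (_ + _).
apply: eq_big_nat => N /andP[_ leNn].
by rewrite subSn // addSn binS addnS addSnnS natrD mulrDl addnS.
Qed.

Lemma sum_binomial_sum (V : pzSemiRingType) (q : nat) (a : nat -> V)
    (p n : nat) :
  \sum_(q <= N < n.+1) binomial_sum q a p N = binomial_sum q a p.+1 n.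
Proof.
elim: n => [|n IHn].
  case: q => [|q]; last by rewrite /binomial_sum !big_geq.
  by rewrite /binomial_sum !big_nat1 !subnn !add0n !binn.
have [le_q_n1 | lt_n1_q] := leqP q n.+1.
  by rewrite big_nat_recr //= IHn binomial_sum_succ.
by rewrite /binomial_sum !big_geq.
Qed.

Lemma nested_sum_binomial (V : pzSemiRingType) (q : nat) (a : nat -> V)
    (m k n : nat) :
  nested_sum q (fun N2 N1 : nat => 'C((N2 - N1) + m, m)%:R * a N1) k.+1 n =
  binomial_sum q a (m + k) n.
Proof.
elim: k n => [|k IHk] n; first by rewrite addn0.
by rewrite addnS -sum_binomial_sum; apply: eq_bigr => N _; apply: IHk.
Qed.

Theorem theorem5p7 (R : realType) (k m q n : nat) (a : nat -> R[i])
    (hk : (0 < k)%N) (hqn : (q <= n)%N) :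
  nested_sum q (fun N2 N1 : nat => 'C((N2 - N1) + m, m)%:R * a N1) k n =
  \sum_(q <= N < n.+1) 'C((n - N) + m + k - 1, m + k - 1)%:R * a N.
Proof.
case: k hk => // k _; rewrite nested_sum_binomial.
by apply: eq_bigr => N _; rewrite !addnS !subn1 /= addnA.
Qed.
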